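(* Let $\lambda\ne0$ with $\lambda<1$, and consider a $\lambda$-exponential family on $\mathbb{R}^d$, with densities (with respect to a reference measure $\nu$) $$p_\theta(y)=(1+\lambda\langle\theta,y\rangle)_+^{1/\lambda}e^{-\varphi(\theta)},\qquad\theta\in\Theta,$$ where $\Theta\subset\mathbb{R}^d$ is open and convex and the potential function $\varphi$ is regular $c_\lambda$-convex on $\Theta$. Given the current parameter $\theta_k\in\Theta$ and an observation $y_k\in\mathbb{R}^d$ with $1+\lambda\langle\theta_k,y_k\rangle>0$, let $$f_k(\theta)=-\log p_\theta(y_k)=\varphi(\theta)-\frac1\lambda\log(1+\lambda\langle\theta,y_k\rangle)$$ be the log-loss, let $\eta_k=\nabla^{(\lambda)}_\theta\varphi(\theta_k)$, let $\delta_k>0$ be the learning rate, and let $\Pi_\lambda(\theta_k)=1+\lambda\langle\theta_k,\eta_k\rangle$. Then the (unconstrained) online natural gradient update $$\eta_{k+1}=\eta_k-\delta_k\,\Pi_\lambda(\theta_k)\,(I_d+\lambda\,\eta_k\theta_k^\top)\,\nabla_\theta f_k(\theta_k)$$ is given by $$\eta_{k+1}=\eta_k+\delta_k\,\frac{1+\lambda\langle\theta_k,\eta_k\rangle}{1+\lambda\langle\theta_k,y_k\rangle}\,(y_k-\eta_k).$$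
   Context: Vectors are column vectors, $\langle\cdot,\cdot\rangle$ is the Euclidean inner product, $I_d$ is the $d\times d$ identity matrix, $\nabla_\theta$ is the Euclidean gradient, $x_+=\max\{x,0\}$. Regular $c_\lambda$-convex function: a smooth function $\varphi:\Theta\to\mathbb{R}$ on an open convex set $\Theta\subset\mathbb{R}^d$ such that $\Phi_\lambda=\frac1\lambda(e^{\lambda\varphi}-1)$ is convex with $\nabla^2_\theta\Phi_\lambda$ positive definite everywhere, and $1-\lambda\langle\nabla_\theta\varphi(\theta),\theta\rangle>0$ for all $\theta\in\Theta$. (For a $\lambda$-exponential family, the normalization function $\varphi$ is $c_\lambda$-convex under suitable regularity conditions, including $\lambda<1$; this is a standing assumption.) The $\lambda$-mirror map is $$\nabla^{(\lambda)}_\theta\varphi(\theta)=\frac{1}{1-\lambda\langle\nabla_\theta\varphi(\theta),\theta\rangle}\nabla_\theta\varphi(\theta),$$ and $\eta=\nabla^{(\lambda)}_\theta\varphi(\theta)$ is the dual variable. *)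

(* Defs.v *)
From HB Require Import structures.
From mathcomp Require Import all_boot all_order all_algebra.
From mathcomp Require Import all_classical all_reals all_analysis.

Set Implicit Arguments.
Unset Strict Implicit.
Unset Printing Implicit Defensive.
Import Order.TTheory GRing.Theory Num.Theory.
Import numFieldNormedType.Exports.

Local Open Scope classical_set_scope.
Local Open Scope ring_scope.

Section euclidean.
Context {R : realType} {d : nat}.
Local Notation V := 'cV[R]_d.
Implicit Types (f : V -> R) (x u v : V).

Definition inner u v : R := (u^T *m v) 0 0.

Definition partial (i : 'I_d) f : V -> R := fun x => 'D_(delta_mx i 0) f x.

Definition gradient f x : V := \col_i partial i f x.

Definition hessian f x : 'M[R]_d := \matrix_(i, j) partial i (partial j f) x.

(* C^oo on the open set D: the partial derivatives of all orders exist and are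
   continuous at every point of D.  The values of f outside D are irrelevant. *)
Definition smooth_on (D : set V) f : Prop :=
  forall (s : seq 'I_d) x, D x ->
    {for x, continuous (foldr partial f s)} /\
    forall i : 'I_d, derivable (foldr partial f s) x (delta_mx i 0).

Definition posdefmx (A : 'M[R]_d) : Prop :=
  A^T = A /\ forall v, v != 0 -> 0 < inner v (A *m v).

End euclidean.

Definition borel_cV (R : realType) (d : nat) :=
  g_sigma_algebraType (@open 'cV[R]_d).

Section lambda_duality.
Context {R : realType} {d : nat}.
Local Notation V := 'cV[R]_d.
Implicit Types (lambda : R) (Theta : set V) (phi : V -> R) (theta y : V).

Definition Phi lambda phi theta : R :=
  lambda^-1 * (expR (lambda * phi theta) - 1).

Record regular_c_convex lambda Theta phi : Prop := RegularCConvex {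
  domain_open : open Theta;
  domain_convex : convex_set Theta;
  potential_smooth : smooth_on Theta phi;
  Phi_convex : convex_function Theta (Phi lambda phi);
  Phi_hessian : forall theta, Theta theta ->
    posdefmx (hessian (Phi lambda phi) theta);
  potential_regular : forall theta, Theta theta ->
    0 < 1 - lambda * inner (gradient phi theta) theta }.

Definition mirror_map lambda phi theta : V :=
  (1 - lambda * inner (gradient phi theta) theta)^-1 *: gradient phi theta.

Definition Pi_fun lambda phi theta : R :=
  1 + lambda * inner theta (mirror_map lambda phi theta).

(* For lambda < 0 the factor 0 `^ lambda^-1 is 0, not +oo.  Under the other
   convention the normalization below forces the points with
   1 + lambda <theta, y> <= 0 to be nu-negligible, so the two integrals agree. *)
Definition density lambda phi theta y : R :=
  Num.max (1 + lambda * inner theta y) 0 `^ lambda^-1 * expR (- phi theta).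

Definition lambda_exponential_family lambda Theta phi
    (nu : {measure set (borel_cV R d) -> \bar R}) : Prop :=
  forall theta, Theta theta ->
    (\int[nu]_y (density lambda phi theta y)%:E = 1)%E.

Definition log_loss lambda phi y theta : R := - ln (density lambda phi theta y).

Lemma log_lossE lambda phi y theta : 0 < 1 + lambda * inner theta y ->
  log_loss lambda phi y theta =
  phi theta - lambda^-1 * ln (1 + lambda * inner theta y).
Proof.
move=> h; rewrite /log_loss /density max_l ?ltW// lnM ?posrE ?powR_gt0 ?expR_gt0//.
by rewrite ln_powR expRK opprD opprK addrC.
Qed.

End lambda_duality.

(* Main.v *)
Require Import Defs.
From HB Require Import structures.
From mathcomp Require Import all_boot all_order all_algebra.
From mathcomp Require Import all_classical all_reals all_analysis.

Set Implicit Arguments.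
Unset Strict Implicit.
Unset Printing Implicit Defensive.
Import Order.TTheory GRing.Theory Num.Theory.
Import numFieldNormedType.Exports.

Local Open Scope classical_set_scope.
Local Open Scope ring_scope.

(** The whole computation rests on two identities.  Write g for the gradient of
phi at theta, eta for the mirror image of theta, P = 1 - lambda <g, theta> and
Q = 1 + lambda <theta, y>.

The first identity is analytic: Q stays positive near theta, so the positive
part in the density is inactive there and differentiating the logarithm gives
grad f = g - Q^-1 y ([gradient_log_loss]).

The second is algebraic.  The matrix M = I + lambda eta theta^T sends a vector
w to w + lambda <theta, w> eta.  Since g = P eta and lambda <theta, g> = 1 - P,
it sends g to P eta + (1 - P) eta = eta ([rank_one_update_gradient]), and it
sends y to y + (Q - 1) eta.  Hence M grad f = eta - Q^-1 (y + (Q - 1) eta),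
which is Q^-1 (eta - y): the unknown gradient of phi has disappeared.
Multiplying by - delta Pi(theta) gives the update. *)

Section inner_product.
Context {R : realType} {d : nat}.
Implicit Types (u v w x y : 'cV[R]_d) (a b : R).

Lemma inner_sumE u v : inner u v = \sum_i u i 0 * v i 0.
Proof. by rewrite /inner mxE; apply: eq_bigr => i _; rewrite mxE. Qed.

Lemma innerC u v : inner u v = inner v u.
Proof. by rewrite !inner_sumE; apply: eq_bigr => i _; rewrite mulrC. Qed.

Lemma innerZr a u v : inner u (a *: v) = a * inner u v.
Proof. by rewrite /inner -scalemxAr mxE. Qed.

Lemma inner_linearl y : linear (fun x => inner x y).
Proof. by move=> a u v; rewrite /inner linearP mulmxDl -scalemxAl !mxE. Qed.

Lemma inner_deltal i y : inner (delta_mx i 0) y = y i 0.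
Proof.
rewrite inner_sumE (bigD1 i)//= mxE !eqxx mul1r big1 ?addr0// => j ji.
by rewrite mxE (negbTE ji) mul0r.
Qed.

Lemma differentiable_innerl y x : differentiable (fun z => inner z y) x.
Proof.
have -> : (fun z => inner z y) = \sum_(i < d) (fun z => y i 0 *: z i 0).
  apply/funext => z; rewrite inner_sumE fct_sumE.
  by apply: eq_bigr => i _; rewrite mulrC.
elim/big_ind: _ => [|f g df dg|i _].
- exact: differentiable_cst.
- exact: differentiableD.
- apply: (@differentiableZ _ _ _ (fun z : 'cV[R]_d => z i 0 : R)).
  exact: differentiable_coord.
Qed.

Lemma differentiable_affine a b y x :
  differentiable (fun z => a + b * inner z y) x.
Proof.
apply: differentiableD; first exact: differentiable_cst.
by apply: (@differentiableZ _ _ _ (fun z => inner z y));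
  exact: differentiable_innerl.
Qed.

Lemma continuous_innerl y : continuous (fun z => inner z y).
Proof. by move=> x; apply/differentiable_continuous/differentiable_innerl. Qed.

Lemma is_derive_innerl x v y : is_derive x v (fun z => inner z y) (inner v y).
Proof.
pose f : {linear 'cV[R]_d -> R} :=
  HB.pack (fun z : 'cV[R]_d => inner z y)
    (GRing.isLinear.Build _ _ _ _ _ (inner_linearl y)).
apply: DeriveDef; first exact/diff_derivable/differentiable_innerl.
rewrite deriveE; last exact: differentiable_innerl.
by rewrite (@diff_lin _ _ _ f)//; exact: continuous_innerl.
Qed.

Lemma rank_one_updateE a u v w :
  (1%:M + a *: (u *m v^T)) *m w = w + (a * inner v w) *: u.
Proof.
rewrite mulmxDl mul1mx -scalemxAl -mulmxA [v^T *m w]mx11_scalar -/(inner v w).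
by rewrite mul_mx_scalar scalerA.
Qed.

End inner_product.

Section log_loss_gradient.
Context {R : realType} {d : nat} (lambda : R) (phi : 'cV[R]_d -> R).
Implicit Types theta x v y : 'cV[R]_d.

(** An affine function is its own first-order expansion, and the differential of
ln at a positive point is multiplication by the inverse of that point; the
derivative of the composite is read off from these two differentials. *)
Lemma is_derive_ln_affine x v y : 0 < 1 + lambda * inner x y ->
  is_derive x v (fun z => ln (1 + lambda * inner z y))
    (lambda * inner v y / (1 + lambda * inner x y)).
Proof.
move=> Qgt0; pose h z := 1 + lambda * inner z y.
have dh : differentiable h x by exact: differentiable_affine.
have hv : is_derive x v h (lambda * inner v y).
  rewrite -[_ * _]add0r; apply: is_deriveD.
  by apply: (@is_deriveZ _ _ _ (fun z => inner z y)) => //;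
    exact: is_derive_innerl.
have lnQ : is_derive (h x) 1 (@ln R) (h x)^-1 by exact: is_derive1_ln.
have dln : differentiable (@ln R) (h x) by apply/derivable1_diffP; case: lnQ.
have dlnh : differentiable (@ln R \o h) x by exact: differentiable_comp.
apply: DeriveDef; first exact: diff_derivable.
rewrite (deriveE v dlnh) diff_comp//= -(deriveE v dh) derive_val.
by rewrite -[X in 'd _ _ X]mulr1 [LHS]linearZ/= -deriveE// derive_val.
Qed.

(** The closed form of the log-loss is only valid where 1 + lambda <z, y> > 0;
this is an open condition on z, which is enough for derivatives. *)
Lemma gradient_log_loss theta y : lambda != 0 ->
    (forall i, derivable phi theta (delta_mx i 0)) ->
    0 < 1 + lambda * inner theta y ->
  gradient (log_loss lambda phi y) theta =
  gradient phi theta - (1 + lambda * inner theta y)^-1 *: y.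
Proof.
move=> l0 dphi Qgt0; apply/matrixP => i j; rewrite !mxE ord1 /partial.
pose L z := ln (1 + lambda * inner z y).
have cQ : {for theta, continuous (fun z => 1 + lambda * inner z y)}.
  exact/differentiable_continuous/differentiable_affine.
have loss_near : \forall z \near theta, log_loss lambda phi y z =
    (phi - lambda^-1 *: L) z.
  near=> z; rewrite log_lossE//; near: z.
  exact: (cvgr_gt _ cQ).
rewrite (near_eq_derive _ loss_near).
have dL : is_derive theta (delta_mx i 0) L _ :=
  is_derive_ln_affine (delta_mx i 0) Qgt0.
have := is_deriveB (derivableP (dphi i)) (is_deriveZ lambda^-1 dL).
move=> [_ ->]; rewrite inner_deltal; congr (_ - _).
by rewrite [LHS]mulrA mulrA mulVf// mul1r mulrC.
Unshelve. all: by end_near. Qed.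

(** The matrix in the natural gradient step undoes the normalization in the
mirror map: it carries the ordinary gradient of phi to the dual variable. *)
Lemma rank_one_update_gradient theta (eta := mirror_map lambda phi theta) :
    1 - lambda * inner (gradient phi theta) theta != 0 ->
  (1%:M + lambda *: (eta *m theta^T)) *m gradient phi theta = eta.
Proof.
move=> P0; rewrite rank_one_updateE (innerC theta).
set P := 1 - _ in P0.
have -> : gradient phi theta + (lambda * inner (gradient phi theta) theta) *: eta
    = P *: eta + (1 - P) *: eta.
  (* The gradient is P *: eta, because eta is the gradient divided by P. *)
  by rewrite [P *: _]scalerA mulfV// scale1r /P subKr.
by rewrite -scalerDl addrC subrK scale1r.
Qed.

End log_loss_gradient.

Theorem theorem5 (R : realType) (d : nat) (lambda : R)
    (nu : {measure set (borel_cV R d) -> \bar R})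
    (Theta : set 'cV[R]_d) (phi : 'cV[R]_d -> R)
    (theta_k y_k eta_k eta_k1 : 'cV[R]_d) (delta_k : R) :
  lambda != 0 -> lambda < 1 ->
  regular_c_convex lambda Theta phi ->
  lambda_exponential_family lambda Theta phi nu ->
  Theta theta_k ->
  0 < 1 + lambda * inner theta_k y_k ->
  0 < delta_k ->
  eta_k = mirror_map lambda phi theta_k ->
  eta_k1 = eta_k - (delta_k * Pi_fun lambda phi theta_k) *:
    ((1%:M + lambda *: (eta_k *m theta_k^T)) *m
       gradient (log_loss lambda phi y_k) theta_k) ->
  eta_k1 = eta_k +
    (delta_k * ((1 + lambda * inner theta_k eta_k) /
                (1 + lambda * inner theta_k y_k))) *: (y_k - eta_k).
Proof.
move=> l0 _ [_ _ phi_smooth _ _ phi_reg] _ Tk Qgt0 _ eta_kE ->.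
have P0 := lt0r_neq0 (phi_reg _ Tk).
rewrite gradient_log_loss//; last first.
  by move=> i; have [_] := phi_smooth [::] _ Tk; exact.
have Pi_eta : Pi_fun lambda phi theta_k = 1 + lambda * inner theta_k eta_k.
  by rewrite eta_kE.
have M_gradient :
    (1%:M + lambda *: (eta_k *m theta_k^T)) *m gradient phi theta_k = eta_k.
  by rewrite eta_kE; exact: rank_one_update_gradient.
rewrite Pi_eta mulmxBr M_gradient rank_one_updateE innerZr.
set Q := 1 + lambda * inner theta_k y_k in Qgt0 *.
have step : eta_k - (Q^-1 *: y_k + (lambda * (Q^-1 * inner theta_k y_k)) *: eta_k)
    = - (Q^-1 *: (y_k - eta_k)).
  have -> : lambda * (Q^-1 * inner theta_k y_k) = 1 - Q^-1.
    rewrite mulrCA (_ : lambda * _ = Q - 1); last by rewrite /Q addrC addKr.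
    by rewrite mulrBr mulr1 mulVf// lt0r_neq0.
  by rewrite scalerBl scale1r addrCA opprD addrA subrr sub0r scalerBr.
by rewrite step scalerN opprK scalerA mulrA.
Qed.
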